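(* Let $\sigma>0$, $\mu\ge 0$ be constants with $2<2\mu\sigma+\sigma^2\pi^2$. Then there exists a constant $\gamma\ge 0$ such that for every $(f,g)\in X$ and every $d\in\Phi(f,g)$ the corresponding solution $u$ satisfies $$\limsup_{t\to+\infty}\|u[t]\|_\infty\le \gamma\,\sup_{t\ge 0}|d(t)|,$$ and moreover $$\gamma_\infty\le G_0\!\left(\frac{\mu\sigma-1}{\sigma^2}\right),$$ where $$G_0(s):=\inf\left\{\frac{1}{\sin(\theta)\,(1-p(s,\theta))}\;:\;0<\theta<\pi-\sqrt{|s|-s}\right\},\qquad p(s,\theta):=\frac{|s|}{s+(\pi-\theta)^2}.$$
   Context: For constants $\sigma>0$, $\mu\ge0$ consider the wave equation with Kelvin-Voigt and viscous damping $$\frac{\partial^2 u}{\partial t^2}(t,x)=\frac{\partial^2 u}{\partial x^2}(t,x)+\sigma\frac{\partial^3 u}{\partial t\,\partial x^2}(t,x)-\mu\frac{\partial u}{\partial t}(t,x),\quad (t,x)\in(0,+\infty)\times(0,1),$$ $$u(t,0)=d(t),\quad u(t,1)=0,\quad t\ge0,$$ with initial conditions $u[0]=f$, $\frac{\partial u}{\partial t}[0]=g$. Here $u[t]$ denotes the profile $x\mapsto u(t,x)$ (and similarly $\frac{\partial u}{\partial t}[t]$), the term $\frac{\partial^3u}{\partial t\,\partial x^2}$ is the second $x$-derivative of $\frac{\partial u}{\partial t}$, and $\mathbb{R}_+=[0,+\infty)$. $\|\cdot\|_\infty$ is the sup norm on $[0,1]$. A solution means a function $u\in C^2(\mathbb{R}_+\times[0,1])$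 with $\frac{\partial u}{\partial t}[t]\in C^2([0,1])$ for all $t\ge0$ satisfying the initial-boundary value problem consisting of the differential equation $\frac{\partial^2 u}{\partial t^2}(t,x)=\frac{\partial^2 u}{\partial x^2}(t,x)+\sigma\frac{\partial^3 u}{\partial t\,\partial x^2}(t,x)-\mu\frac{\partial u}{\partial t}(t,x)$ for $(t,x)\in(0,+\infty)\times(0,1)$, the boundary conditions $u(t,0)=d(t)$, $u(t,1)=0$ for $t\ge0$, and the initial conditions $u[0]=f$, $\frac{\partial u}{\partial t}[0]=g$. $X$ is the set of all $(f,g)\in C^2([0,1])\times C^2([0,1])$ for which there exists a bounded $d\in C^2(\mathbb{R}_+)$ such that the initial-boundary value problem has a unique solution. For $(f,g)\in X$, $\Phi(f,g)$ is the set of bounded $d\in C^2(\mathbb{R}_+)$ for which the initial-boundary value problem with data $f,g,d$ has a unique solution. The asymptotic gain of the displacement in the sup norm is $$\gamma_\infty:=\sup\left\{\frac{\limsup_{t\to+\infty}\|u[t]\|_\infty}{\sup_{t\ge0}|d(t)|}\;:\;(f,g)\in X,\ d\in\Phi(f,g),\ d\ne0\right\},$$ where $u$ is the solution corresponding to $f,g,d$. *)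

(* Defs.v *)
From HB Require Import structures.
From mathcomp Require Import all_boot all_order all_algebra.
From mathcomp Require Import all_classical all_reals all_analysis.

Set Implicit Arguments.
Unset Strict Implicit.
Unset Printing Implicit Defensive.

Import Order.TTheory GRing.Theory Num.Theory.
Import numFieldNormedType.Exports.

Local Open Scope classical_set_scope.
Local Open Scope ring_scope.

(* Functions on R_+, [0, 1] or R_+ x [0, 1] are total functions; every notion
   below depends only on their values on these sets, so values outside are
   irrelevant.  Derivatives are taken relative to the set: two-sided at interior
   points, one-sided at end points. *)

Definition diffquot (R : realType) (f : R -> R) (x y : R) : R :=
  (f y - f x) / (y - x).

Definition derivable_in (R : realType) (A : set R) (f : R -> R) (x : R) : Prop :=
  cvg (diffquot f x @ within A x^').

Definition derive_in (R : realType) (A : set R) (f : R -> R) (x : R) : R :=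
  lim (diffquot f x @ within A x^').

Fixpoint Ck_on (R : realType) (k : nat) (A : set R) (f : R -> R) : Prop :=
  {within A, continuous f} /\
  if k is k'.+1 then
    (forall x, A x -> derivable_in A f x) /\ Ck_on k' A (derive_in A f)
  else True.

Definition halfline (R : realType) : set R := [set t | 0 <= t].
Arguments halfline : clear implicits.

Definition unitI (R : realType) : set R := [set x | 0 <= x <= 1].
Arguments unitI : clear implicits.

Section Wave.
Variable R : realType.
Implicit Types (u v : R -> R -> R) (f g d : R -> R).

Definition dt u : R -> R -> R :=
  fun t x => derive_in (halfline R) (fun s => u s x) t.

Definition dx u : R -> R -> R :=
  fun t x => derive_in (unitI R) (u t) x.

Definition has_partials u : Prop :=
  forall t x, halfline R t -> unitI R x ->
    derivable_in (halfline R) (fun s => u s x) t /\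
    derivable_in (unitI R) (u t) x.

Fixpoint Ck_strip (k : nat) u : Prop :=
  {within halfline R `*` unitI R, continuous (fun z : R * R => u z.1 z.2)} /\
  if k is k'.+1 then
    [/\ has_partials u, Ck_strip k' (dt u) & Ck_strip k' (dx u)]
  else True.

Definition is_solution (sigma mu : R) f g d u : Prop :=
  [/\ Ck_strip 2 u /\ (forall t, 0 <= t -> Ck_on 2 (unitI R) (dt u t)),
      forall t x, 0 < t -> 0 < x < 1 ->
        dt (dt u) t x =
          dx (dx u) t x + sigma * dx (dx (dt u)) t x - mu * dt u t x,
      forall t, 0 <= t -> u t 0 = d t /\ u t 1 = 0
    & forall x, 0 <= x <= 1 -> u 0 x = f x /\ dt u 0 x = g x].

Definition has_unique_solution (sigma mu : R) f g d : Prop :=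
  exists2 u, is_solution sigma mu f g d u
    & forall v, is_solution sigma mu f g d v ->
        forall t x, 0 <= t -> 0 <= x <= 1 -> v t x = u t x.

Definition input d : Prop :=
  Ck_on 2 (halfline R) d /\ exists M : R, forall t, 0 <= t -> `|d t| <= M.

Definition Phi (sigma mu : R) f g : set (R -> R) :=
  [set d | input d /\ has_unique_solution sigma mu f g d].

Definition X (sigma mu : R) : set ((R -> R) * (R -> R)) :=
  [set fg | [/\ Ck_on 2 (unitI R) fg.1, Ck_on 2 (unitI R) fg.2
             & exists d, Phi sigma mu fg.1 fg.2 d]].

Local Open Scope ereal_scope.

Definition sup_abs_on (A : set R) (h : R -> R) : \bar R :=
  ereal_sup [set `|h x|%:E | x in A].

Definition limsup_norm u : \bar R :=
  limf_esup (fun t : R => sup_abs_on (unitI R) (u t)) (pinfty_nbhs R).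

Definition gamma_infty (sigma mu : R) : \bar R :=
  ereal_sup [set r | exists f g d u,
    [/\ X sigma mu (f, g), Phi sigma mu f g d,
        (exists t : R, (0 <= t)%R /\ d t != 0%R),
        is_solution sigma mu f g d u
      & r = limsup_norm u / sup_abs_on (halfline R) d]].

Definition p (s theta : R) : R := (`|s| / (s + (pi - theta) ^+ 2))%R.

Definition G0 (s : R) : \bar R :=
  ereal_inf [set (1 / (sin theta * (1 - p s theta)))%R%:E | theta in
    [set theta : R | (0 < theta < pi - Num.sqrt (`|s| - s))%R]].

End Wave.

(* Main.v *)
(* With s = (mu sigma - 1) / sigma^2 and w = u_t + sigma s u - sigma u_xx, the
   wave equation splits into a heat equation coupled with an ordinary
   differential equation:
     u_t = sigma (u_xx - s u) + w,      w_t = s u - w / sigma.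
   Take phi(x) = sin(theta + omega x) with sqrt(|s| - s) < omega < pi - theta,
   so that phi > 0 on [0, 1], phi'' = - omega^2 phi and |s| < s + omega^2.  The
   last inequality is a small-gain condition: for some k, e > 0, the bounds
     |u| <= phi U,   |w| <= k phi U,   U(t) = A + B exp(- e t)
   are preserved in time as soon as |d| <= A sin theta, by the maximum principle
   for u and the variation of constants for w.  Hence the gain is at most
   1 / sin theta, which is at most 1 / (sin theta (1 - p(s, theta))). *)

Require Import Defs.
From mathcomp Require Import all_boot all_order all_algebra.
From mathcomp Require Import all_classical all_reals all_analysis.
From mathcomp Require Import ring lra.
Import Order.TTheory GRing.Theory Num.Theory.
Import numFieldNormedType.Exports.
Local Open Scope classical_set_scope.
Local Open Scope ring_scope.

(** * Derivatives relative to a set and the mean value theorem *)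

Lemma is_derive_diffquotP {R : realType} (f : R -> R) (x l : R) :
  is_derive x 1 f l <-> diffquot f x @ x^' --> l.
Proof.
(* The Carathéodory slope: the difference quotient, completed at [x] by the value [l]. *)
pose g z := if z == x then l else diffquot f x z.
have gE : \forall z \near x^', g z = diffquot f x z.
  near=> z; rewrite /g ifN //.
  by near: z; exact: nbhs_dnbhs_neq.
have gx : g x = l by rewrite /g eqxx.
rewrite is_derive1_caratheodory; split.
- move=> [h [hE hc hx]].
  have hl := (continuous_withinNx _ _).1 hc; rewrite hx in hl.
  apply: cvg_trans hl; apply: near_eq_cvg; near=> z.
  have zx : z != x by near: z; exact: nbhs_dnbhs_neq.
  by rewrite /diffquot hE mulfK // subr_eq0.
- move=> dl; exists g; split => //.
  + move=> z; rewrite /g; case: eqVneq => [->|zx]; first by rewrite !subrr mulr0.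
    by rewrite /diffquot divfK // subr_eq0.
  + apply/continuous_withinNx; rewrite gx.
    apply: cvg_trans dl; apply: near_eq_cvg.
    by apply: filterS gE => z ->.
Unshelve. all: by end_near. Qed.

(** When [A] is a neighbourhood of [x], the filters [within A x^'] and [x^'] coincide, so at
    interior points the relative derivatives of the problem are ordinary ones. *)
Lemma is_derive_in {R : realType} (A : set R) (f : R -> R) (x : R) :
  nbhs x A -> derivable_in A f x -> is_derive x 1 f (derive_in A f x).
Proof.
move=> Ax df; apply/is_derive_diffquotP.
suff AE : within A x^' = x^' by rewrite -[X in _ @ X --> _]AE.
apply/seteqP; split=> P PA.
- suff : \forall z \near x, z != x -> P z by [].
  have {}PA : \forall z \near x, z != x -> A z -> P z by [].
  by apply: filterS2 PA Ax => z + Az zx; exact.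
- suff : \forall z \near x, z != x -> A z -> P z by [].
  have {}PA : \forall z \near x, z != x -> P z by [].
  by apply: filterS PA => z + zx _; exact.
Qed.

Lemma is_derive_eps {R : realType} (f : R -> R) (x l : R) :
  (forall e, 0 < e -> \forall y \near x,
     `|f y - f x - (y - x) * l| <= e * `|y - x|) ->
  is_derive x 1 f l.
Proof.
move=> H; apply/is_derive_diffquotP/cvgrPdist_le => e e0; near=> y.
have yx : 0 < `|y - x|.
  by rewrite normr_gt0 subr_eq0; near: y; exact: nbhs_dnbhs_neq.
rewrite distrC -(ler_pM2r yx) -normrM mulrBl divfK -?normr_gt0//.
rewrite [l * _]mulrC; near: y; apply: nbhs_dnbhs; exact: H.
Unshelve. all: by end_near. Qed.

Lemma is_derive_continuous {R : realType} (f : R -> R) (x l : R) :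
  is_derive x 1 f l -> {for x, continuous f}.
Proof.
by move=> d; apply/differentiable_continuous/derivable1_diffP/(@ex_derive _ _ _ _ _ _ _ d).
Qed.

(** The endpoints are unordered because a time increment around an interior time may have either
    sign. *)
Lemma MVT_between {R : realType} (f df : R -> R) (x y : R) :
  (forall z, Num.min x y <= z <= Num.max x y -> is_derive z 1 f (df z)) ->
  exists2 z, Num.min x y <= z <= Num.max x y & f y - f x = df z * (y - x).
Proof.
wlog xy : x y / x <= y => [H d|d].
  have /orP[xy|yx] := le_total x y; first exact: H.
  have := H y x yx; rewrite minC maxC => /(_ d)[z zyx E].
  by exists z => //; rewrite -opprB E -mulrN opprB.
rewrite min_l // max_r // in d *.
have [||z zi E] := @MVT_segment _ f df _ _ xy.
- by move=> z /subset_itv_oo_cc/d.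
- by apply: continuous_in_subspaceT => z /set_mem/d/is_derive_continuous.
- by exists z; rewrite // -(@in_itv _ _ z (Interval (BLeft x) (BRight y))).
Qed.

Lemma is_derive_shift {R : realType} (f : R -> R) (x h l : R) :
  is_derive (x + h) 1 f l -> is_derive x 1 (fun y => f (y + h)) l.
Proof.
move=> d; have dD : is_derive x 1 (fun y : R => y + h) 1.
  by rewrite -[X in is_derive _ _ _ X]addr0; apply: is_deriveD.
by rewrite -[l]mulr1; exact: (@is_derive1_comp _ f (fun y => y + h)).
Qed.

(** * Second differences and the time derivative of the second space derivative *)

Definition diff2 {R : realType} (f : R -> R) (x h : R) :=
  f (x + h) + f (x - h) - 2 * f x.

(** The second difference is the increment of [f (y + h) - f y] from [x - h] to [x]; the mean value
    theorem is applied to this function, then to [f1]. *)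
Lemma diff2_mean {R : realType} (f f1 f2 : R -> R) (x h : R) : 0 < h ->
  (forall y, `|y - x| <= h -> is_derive y 1 f (f1 y)) ->
  (forall y, `|y - x| <= h -> is_derive y 1 f1 (f2 y)) ->
  exists2 y, `|y - x| <= h & diff2 f x h = f2 y * h ^+ 2.
Proof.
move=> h0 d1 d2.
have xhx : x - h <= x by lra.
have [|z] := @MVT_between _ (fun y => f (y + h) - f y)
    (fun y => f1 (y + h) - f1 y) (x - h) x.
  rewrite min_l // max_r // => z zx.
  apply: is_deriveB; last by apply: d1; rewrite ler_norml; lra.
  by apply/is_derive_shift/d1; rewrite ler_norml; lra.
rewrite min_l // max_r // => zx E.
have zzh : z <= z + h by lra.
have [|y] := @MVT_between _ f1 f2 z (z + h).
  rewrite min_l // max_r // => y yz.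
  by apply: d2; rewrite ler_norml; lra.
rewrite min_l // max_r // => yz E'.
exists y; first by rewrite ler_norml; lra.
transitivity (f (x + h) - f x - (f (x - h + h) - f (x - h))).
  by rewrite /diff2 subrK; ring.
by rewrite E E'; ring.
Qed.

Lemma continuous_dist {R : realType} {V : pseudoMetricType R} (f : V -> R) (x : V) :
  {for x, continuous f} -> forall e, 0 < e ->
  exists2 r : R, 0 < r & forall y, ball x r y -> `|f y - f x| <= e.
Proof.
move=> /cvgrPdist_le fx e e0; have /nbhs_ballP[r r0 fr] := fx _ e0.
by exists r => // y /fr /=; rewrite distrC.
Qed.

Lemma diff2_is_derive {R : realType} (u ut : R -> R -> R) (t x h : R) :
  (forall y, `|y - x| <= `|h| -> is_derive t 1 (u ^~ y) (ut t y)) ->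
  is_derive t 1 (fun s => diff2 (u s) x h) (diff2 (ut t) x h).
Proof.
move=> d; apply: is_deriveB.
  apply: is_deriveD; apply: d; first by rewrite addrAC subrr add0r.
  by rewrite addrAC subrr add0r normrN.
have dx : is_derive t 1 (u ^~ x) (ut t x) by apply: d; rewrite subrr normr0.
exact: (is_deriveZ 2 dx).
Qed.

(* The second difference quotient of [u t] in [x] tends to [uxx t x], and by the
   mean value theorem its increments in [t] are values of [utxx]; no symmetry of
   mixed derivatives is required. *)
Lemma is_derive_dxx {R : realType} (u ut ux uxx utx utxx : R -> R -> R)
    (t x r : R) : 0 < r ->
  (forall s y, `|s - t| <= r -> `|y - x| <= r ->
    [/\ is_derive s 1 (u ^~ y) (ut s y), is_derive y 1 (u s) (ux s y),
        is_derive y 1 (ux s) (uxx s y), is_derive y 1 (ut s) (utx s y)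
      & is_derive y 1 (utx s) (utxx s y)]) ->
  (forall s, `|s - t| <= r -> {for x, continuous (uxx s)}) ->
  {for (t, x), continuous (fun z : R * R => utxx z.1 z.2)} ->
  is_derive t 1 (uxx ^~ x) (utxx t x).
Proof.
move=> r0 d cuxx cutxx; apply: is_derive_eps => e e0.
have [q q0 Hq] := continuous_dist _ _ cutxx _ e0.
have rq0 : 0 < Num.min r q by rewrite lt_min r0.
have st0 : \forall s \near t, `|t - s| < Num.min r q.
  exact: (nbhsx_ballx t _ rq0).
near=> s; have : `|s - t| < Num.min r q by rewrite distrC; near: s.
rewrite lt_min => /andP[str stq]; have str' := ltW str.
(* The slack [n] pays for replacing [uxx s] and [uxx t] at [x] by their values at nearby points.
   Since [h] is chosen after [s] and [n], its size may depend on both. *)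
apply/ler_addgt0Pr => n n0; have n20 : 0 < n / 2 by lra.
have tr : `|t - t| <= r by rewrite subrr normr0 ltW.
have [q1 q10 H1] := continuous_dist _ _ (cuxx _ str') _ n20.
have [q2 q20 H2] := continuous_dist _ _ (cuxx _ tr) _ n20.
pose h := Num.min (Num.min r q) (Num.min q1 q2) / 2.
have [h0 hr hq h1 h2] : [/\ 0 < h, h <= r, h < q, h < q1 & h < q2].
  have m0 : 0 < Num.min (Num.min r q) (Num.min q1 q2) by rewrite !lt_min r0 q0 q10.
  have : Num.min (Num.min r q) (Num.min q1 q2) <= Num.min (Num.min r q) (Num.min q1 q2) by [].
  rewrite {2}/Num.min !le_min -/h => /andP[/andP[? ?] /andP[? ?]].
  by rewrite /h; split; lra.
have hn0 : h ^+ 2 != 0 by rewrite expf_neq0 ?gt_eqF.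
have dx w : `|w - t| <= r -> exists2 y, `|y - x| <= h & diff2 (u w) x h = uxx w y * h ^+ 2.
  by move=> wt; apply: (@diff2_mean _ _ (ux w)) => // y yx; have [] := d w y wt (le_trans yx hr).
have [y1 y1x E1] := dx _ str'.
have [y2 y2x E2] := dx _ tr.
have [w wts|z zts] := @MVT_between _ (fun w => diff2 (u w) x h)
     (fun w => diff2 (ut w) x h) t s.
  apply: diff2_is_derive => y; rewrite (gtr0_norm h0) => yx.
  suff wt : `|w - t| <= r by have [] := d w y wt (le_trans yx hr).
  move: str'; rewrite !ler_norml; move: wts; rewrite /Num.min /Num.max; case: ltP; lra.
have zs : `|z - t| <= `|s - t|.
  move: zts; rewrite /Num.min /Num.max; case: ltP => ts /andP[z1 z2].
    by rewrite !ger0_norm; lra.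
  by rewrite (distrC z) (distrC s) !ger0_norm; lra.
have zr := le_trans zs str'.
have [||y3 y3x E3] := @diff2_mean _ (ut z) (utx z) (utxx z) x h h0.
- by move=> y yx; have [] := d z y zr (le_trans yx hr).
- by move=> y yx; have [] := d z y zr (le_trans yx hr).
(* Cancelling [h ^+ 2] leaves the exact identity [uxx s y1 - uxx t y2 = utxx z y3 * (s - t)]. Moving
   [y1] and [y2] to [x] costs [n / 2] each, and moving [(z, y3)] to [(t, x)] costs [e * |s - t|]. *)
rewrite E1 E2 E3 -mulrBl mulrAC => /(mulIf hn0) E.
have B1 : `|uxx s y1 - uxx s x| <= n / 2.
  by apply: H1; rewrite /ball /= distrC; exact: le_lt_trans h1.
have B2 : `|uxx t y2 - uxx t x| <= n / 2.
  by apply: H2; rewrite /ball /= distrC; exact: le_lt_trans h2.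
have B3 : `|utxx z y3 - utxx t x| <= e.
  apply: (Hq (z, y3)); split; rewrite /ball /= distrC.
    exact: le_lt_trans stq.
  exact: le_lt_trans hq.
have -> : uxx s x - uxx t x - (s - t) * utxx t x =
   (utxx z y3 - utxx t x) * (s - t) + ((uxx t y2 - uxx t x) - (uxx s y1 - uxx s x)).
  by rewrite [in RHS]mulrBl -E; ring.
apply: le_trans (ler_normD _ _) _; rewrite normrM lerD //; first by rewrite ler_wpM2r.
by apply: le_trans (ler_normB _ _) _; lra.
Unshelve. all: by end_near. Qed.

(** * Derivative tests at a maximum and a linear differential inequality *)

Lemma left_max_derive_ge0 {R : realType} (f : R -> R) (a t l : R) : a < t ->
  (forall s, a < s < t -> f s <= f t) -> is_derive t 1 f l -> 0 <= l.
Proof.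
move=> at0 fmax /is_derive_diffquotP/cvgrPdist_lt df.
rewrite leNgt; apply/negP => l0.
have /nbhs_ballP[r /= r0 rP] : \forall s \near t, s != t -> `|l - diffquot f t s| < - l.
  by apply: (df (- l)); rewrite oppr_gt0.
have [r1 a1 m0] : [/\ Num.min r (t - a) <= r, Num.min r (t - a) <= t - a & 0 < Num.min r (t - a)].
  by rewrite lt_min r0 subr_gt0 at0 !ge_min !lexx orbT.
pose s := t - Num.min r (t - a) / 2.
have st : s < t by rewrite /s; lra.
have /rP : ball t r s by rewrite /ball /= /s subKr gtr0_norm; lra.
rewrite lt_eqF // => /(_ isT); rewrite ltNge ler_normr.
have fs : f s <= f t by apply: fmax; rewrite st andbT /s; lra.
rewrite (_ : - l <= - (l - diffquot f t s)) ?orbT // opprB lerBrDr addNr.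
by rewrite /diffquot mulr_le0 // ?subr_le0 // invr_le0 subr_le0 ltW.
Qed.

(** At a maximum the second difference is nonpositive, and it equals [h ^+ 2] times a value of [f2]
    near [x]; continuity of [f2] carries the sign to [x] itself. *)
Lemma max_derive2_le0 {R : realType} (f f1 f2 : R -> R) (x r : R) : 0 < r ->
  (forall y, `|y - x| <= r -> is_derive y 1 f (f1 y)) ->
  (forall y, `|y - x| <= r -> is_derive y 1 f1 (f2 y)) ->
  {for x, continuous f2} ->
  (forall y, `|y - x| <= r -> f y <= f x) -> f2 x <= 0.
Proof.
move=> r0 d1 d2 cf2 fmax; apply/ler_addgt0Pr => e e0.
have [q q0 fq] := continuous_dist _ _ cf2 _ e0.
pose h := Num.min r q / 2.
have [hr hq h0] : [/\ h <= r, h < q & 0 < h].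
  have : Num.min r q <= Num.min r q by [].
  have : 0 < Num.min r q by rewrite lt_min r0.
  by rewrite {3}/Num.min le_min -/h => ? /andP[? ?]; rewrite /h; split; lra.
have [y yx|y yx|y yx E] := @diff2_mean _ f f1 f2 x h h0.
- exact/d1/(le_trans yx).
- exact/d2/(le_trans yx).
have : diff2 f x h <= 0.
  have hh : `|h| = h by rewrite gtr0_norm.
  have Hp : f (x + h) <= f x by apply: fmax; rewrite addrAC subrr add0r hh.
  have Hm : f (x - h) <= f x by apply: fmax; rewrite addrAC subrr add0r normrN hh.
  by rewrite /diff2; lra.
rewrite E pmulr_lle0 ?exprn_gt0 // => f2y.
have : `|f2 y - f2 x| <= e.
  by apply: fq; rewrite /ball /= distrC; exact: le_lt_trans hq.
by rewrite ler_norml; lra.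
Qed.

(** With the integrating factor [expR (c * t)], the product [E t * h t] has nonpositive
    derivative. *)
Lemma linear_decay_le0 {R : realType} (h dh : R -> R) (c T : R) : 0 <= T ->
  {within `[0, T], continuous h} ->
  (forall t, 0 < t < T -> is_derive t 1 h (dh t)) ->
  (forall t, 0 < t < T -> dh t <= - c * h t) ->
  h 0 <= 0 -> h T <= 0.
Proof.
move=> T0 ch dhE dhle h0.
pose E t := expR (c * t).
have dE (t : R) : is_derive t 1 E (E t * c).
  apply: (@is_derive1_comp _ expR (fun t => c * t)).
  by rewrite -[X in is_derive _ _ _ X]mulr1; exact: (is_deriveZ c (is_derive_id t (1 : R))).
have cE : continuous E by move=> t; exact: is_derive_continuous (dE t).
have [|T_gt0] := eqVneq T 0; first by move=> ->.
have {}T0 : 0 < T by rewrite lt_neqAle eq_sym T_gt0.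
have [||t] := @MVT _ (fun t => E t * h t)
   (fun t => E t * dh t + h t * (E t * c)) 0 T T0.
- by move=> t; rewrite in_itv /= => /dhE dht; exact: (is_deriveM (dE t) dht).
- move=> t; apply: (@continuousM _ (subspace `[0, T]) E h); last exact: ch.
  exact: (continuous_subspaceT cE).
rewrite in_itv /= => /dhle dht.
have -> : E 0 = 1 by rewrite /E mulr0 expR0.
rewrite mul1r subr0 => EhT.
have Et : 0 < E t by exact: expR_gt0.
have ET : 0 < E T by exact: expR_gt0.
have dEh : (E t * dh t + h t * (E t * c)) * T <= 0.
  rewrite mulr_le0_ge0 ?(ltW T0) // [h t * _]mulrCA -mulrDr.
  by rewrite pmulr_rle0 //; move: dht; rewrite mulNr; lra.
by rewrite -(pmulr_rle0 _ ET); lra.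
Qed.

(** * The spatial weight and the temporal envelope *)

Definition weight {R : realType} (theta omega x : R) := sin (theta + omega * x).

Definition envelope {R : realType} (A B e t : R) := A + B * expR (- e * t).

Section Weight.
Context {R : realType} (theta omega : R).
Hypotheses (theta_gt0 : 0 < theta) (omega_gt0 : 0 < omega)
  (sum_ltpi : theta + omega < pi).
Local Notation phi := (weight theta omega).

Lemma weight_gt0 x : 0 <= x <= 1 -> 0 < phi x.
Proof.
move=> /andP[x0 x1]; apply: sin_gt0_pi; apply/andP; split.
  by rewrite ltr_pwDl // mulr_ge0 // ltW.
by apply: le_lt_trans sum_ltpi; rewrite lerD2l ler_piMr // ltW.
Qed.

Lemma is_derive_affine (x : R) : is_derive x 1 (fun x : R => theta + omega * x) omega.
Proof.
rewrite -[X in is_derive _ _ _ X]add0r -[X in is_derive _ _ _ (_ + X)]mulr1.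
by apply: is_deriveD; exact: (is_deriveZ omega (is_derive_id x (1 : R))).
Qed.

Lemma is_derive_weight (x : R) :
  is_derive x 1 phi (omega * cos (theta + omega * x)).
Proof.
rewrite mulrC.
exact: (@is_derive1_comp _ sin _ x _ _ (is_derive_sin _) (is_derive_affine x)).
Qed.

Lemma is_derive2_weight (x : R) :
  is_derive x 1 (fun x : R => omega * cos (theta + omega * x)) (- omega ^+ 2 * phi x).
Proof.
have d := @is_derive1_comp _ cos _ x _ _ (is_derive_cos _) (is_derive_affine x).
rewrite (_ : _ * phi x = omega *: (- sin (theta + omega * x) * omega)).
  exact: (is_deriveZ omega d).
by rewrite /weight /GRing.scale /=; ring.
Qed.

Lemma continuous_weight : continuous phi.
Proof. by move=> x; exact: is_derive_continuous (is_derive_weight x). Qed.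

End Weight.

Section Envelope.
Context {R : realType} (A B e : R).
Local Notation U := (envelope A B e).

Lemma is_derive_envelope (t : R) : is_derive t 1 U (- e * (U t - A)).
Proof.
have dl : is_derive t 1 (fun t : R => - e * t) (- e).
  by rewrite -[X in is_derive _ _ _ X]mulr1; exact: (is_deriveZ (- e) (is_derive_id t (1 : R))).
have d := @is_derive1_comp _ expR _ t _ _ (is_derive_expR _) dl.
rewrite (_ : _ * _ = 0 + B *: (expR (- e * t) * - e)).
  by apply: is_deriveD; exact: (is_deriveZ B d).
by rewrite /envelope /GRing.scale /=; ring.
Qed.

Lemma continuous_envelope : continuous U.
Proof. by move=> t; exact: is_derive_continuous (is_derive_envelope t). Qed.

Lemma envelope0 : U 0 = A + B.
Proof. by rewrite /envelope mulr0 expR0 mulr1. Qed.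

Lemma envelope_gtl t : 0 < B -> A < U t.
Proof. by move=> B0; rewrite ltrDl mulr_gt0 // expR_gt0. Qed.

End Envelope.

(** * Comparison principle for the coupled heat equation and ordinary differential equation *)

Section Comparison.
Context {R : realType} (theta omega sigma s k e A B : R).
Hypotheses (theta_gt0 : 0 < theta) (omega_gt0 : 0 < omega)
  (sum_ltpi : theta + omega < pi).
Hypotheses (sigma_gt0 : 0 < sigma) (k_gt0 : 0 < k) (e_gt0 : 0 < e).
Hypotheses (ks : `|s| <= k * (sigma^-1 - e))
  (ke : k + e < sigma * (s + omega ^+ 2)).
Hypotheses (A_ge0 : 0 <= A) (B_gt0 : 0 < B).
Local Notation phi := (weight theta omega).
Local Notation U := (envelope A B e).

(** Put [P = M * phi x * U t]. Touching from below forces [ut >= - e * P] and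
    [uxx t x <= - omega ^+ 2 * P], so the heat equation with [w <= k * P] gives
    [sigma * (s + omega ^+ 2) <= k + e], against [ke]. *)
Lemma no_interior_touching (u ux uxx : R -> R -> R) (ut w M t x : R) :
  0 < t -> 0 < x < 1 -> 0 < M ->
  is_derive t 1 (u ^~ x) ut ->
  (forall y : R, 0 < y < 1 -> is_derive y 1 (u t) (ux t y)) ->
  (forall y : R, 0 < y < 1 -> is_derive y 1 (ux t) (uxx t y)) ->
  {for x, continuous (uxx t)} ->
  ut = sigma * (uxx t x - s * u t x) + w ->
  (forall r, 0 < r < t -> u r x <= M * phi x * U r) ->
  (forall y, 0 < y < 1 -> u t y <= M * phi y * U t) ->
  u t x = M * phi x * U t ->
  ~ w <= M * k * phi x * U t.
Proof.
move=> t0 x01 M0 dut dux duxx cuxx pde umt umx uE wle.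
have [x0 x1] := andP x01.
have phi0 : 0 < phi x by apply: weight_gt0; rewrite // !ltW.
have AU : A < U t by exact: envelope_gtl.
have U0 : 0 < U t by apply: le_lt_trans AU.
have P0 : 0 < M * phi x * U t by rewrite !mulr_gt0.
have Hut : - e * (M * phi x * U t) <= ut.
  have dh : is_derive t 1 (fun r => u r x - M * phi x * U r)
      (ut - M * phi x * (- e * (U t - A))).
    exact: (is_deriveB dut (is_deriveZ (M * phi x) (is_derive_envelope _ _ _ _))).
  (* Only earlier times are compared, since the touching time may be the last one considered. *)
  have : 0 <= ut - M * phi x * (- e * (U t - A)).
    apply: (left_max_derive_ge0 _ 0 _ _ t0 _ dh) => r rt.
    by rewrite uE subrr subr_le0 umt.
  have : 0 <= M * phi x * (e * A) by rewrite !mulr_ge0 // ltW.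
  by lra.
have Huxx : uxx t x <= - omega ^+ 2 * (M * phi x * U t).
  pose r := Num.min x (1 - x) / 2.
  have [r0 rx rx1] : [/\ 0 < r, r < x & r < 1 - x].
    have : Num.min x (1 - x) <= Num.min x (1 - x) by [].
    have : 0 < Num.min x (1 - x) by rewrite lt_min x0 subr_gt0.
    by rewrite {3}/Num.min le_min -/r => ? /andP[? ?]; rewrite /r; split; lra.
  have y01 y : `|y - x| <= r -> 0 < y < 1 by rewrite ler_norml; lra.
  have cphi : continuous phi by exact: continuous_weight.
  have := @max_derive2_le0 _ (fun y => u t y - (M * U t) * phi y)
    (fun y => ux t y - (M * U t) * (omega * cos (theta + omega * y)))
    (fun y => uxx t y - (M * U t) * (- omega ^+ 2 * phi y)) x r r0.
  move=> H; suff : uxx t x - (M * U t) * (- omega ^+ 2 * phi x) <= 0 by lra.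
  apply: H.
  - move=> y /y01 /dux d.
    exact: (is_deriveB d (is_deriveZ (M * U t) (is_derive_weight _ _ _))).
  - move=> y /y01 /duxx d.
    exact: (is_deriveB d (is_deriveZ (M * U t) (is_derive2_weight _ _ _))).
  - apply: continuousB => //; apply: continuousM; first exact: cst_continuous.
    by apply: continuousM; [exact: cst_continuous|exact: cphi].
  - move=> y /y01 /umx uy.
    have -> : u t x - M * U t * phi x = 0 by rewrite uE; ring.
    by rewrite subr_le0; apply: le_trans uy _; lra.
have : sigma * uxx t x <= sigma * (- omega ^+ 2 * (M * phi x * U t)).
  by rewrite ler_pM2l.
have : (k + e) * (M * phi x * U t) < sigma * (s + omega ^+ 2) * (M * phi x * U t).
  by rewrite ltr_pM2r.
by move: pde; rewrite uE; lra.
Qed.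

(** By [ks] and [U' >= - e * U], the function [K * k * U] is a supersolution of
    [w' = s * u - w / sigma] whenever [|u| <= K * U]. The one-sided bound [key] is applied to [w]
    and to [- w]. *)
Lemma ode_bound (u w : R -> R) (K T : R) : 0 <= T -> 0 <= K ->
  {within `[0, T], continuous w} ->
  (forall t : R, 0 < t < T -> is_derive t 1 w (s * u t - w t / sigma)) ->
  (forall t, 0 < t < T -> `|u t| <= K * U t) ->
  `|w 0| <= K * k * U 0 -> `|w T| <= K * k * U T.
Proof.
move=> T0 K0.
have key (v z : R -> R) : {within `[0, T], continuous z} ->
    (forall t : R, 0 < t < T -> is_derive t 1 z (s * v t - z t / sigma)) ->
    (forall t, 0 < t < T -> `|v t| <= K * U t) ->
    z 0 <= K * k * U 0 -> z T <= K * k * U T.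
  move=> cz dz vle z0; rewrite -subr_le0.
  apply: (linear_decay_le0 (fun t => z t - K * k * U t)
    (fun t => (s * v t - z t / sigma) - K * k * (- e * (U t - A))) sigma^-1 T T0).
  - have cU : continuous (fun t => K * k * U t).
      move=> t.
      exact: is_derive_continuous (is_deriveZ (K * k) (is_derive_envelope A B e t)).
    by apply: within_continuousB => //; exact: continuous_subspaceT.
  - move=> t /dz d.
    exact: (is_deriveB d (is_deriveZ (K * k) (is_derive_envelope _ _ _ _))).
  - move=> t /vle vt.
    have U0 : 0 < U t by apply: le_lt_trans (envelope_gtl _ _ _ _ B_gt0).
    have svt : s * v t <= `|s| * (K * U t).
      by apply: le_trans (ler_norm _) _; rewrite normrM ler_wpM2l.
    have ksU : `|s| * (K * U t) <= k * (sigma^-1 - e) * (K * U t).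
      by rewrite ler_wpM2r // mulr_ge0 // ltW.
    have KA : - (K * k * (- e * (U t - A))) <= K * k * e * U t.
      have : 0 <= K * k * e * A by rewrite !mulr_ge0 // ltW.
      by lra.
    lra.
  - by rewrite subr_le0.
move=> cw dw ule; rewrite !ler_norml => /andP[w0 w0'].
apply/andP; split; last exact: key ule _.
rewrite lerNl; apply: (key (fun t => - u t) (fun t => - w t)).
- by move=> t; apply: continuousN; exact: cw.
- move=> t /dw d; rewrite mulrN mulNr -opprD.
  exact: (is_deriveN d).
- by move=> t /ule; rewrite normrN.
- by rewrite lerNl.
Qed.

(* The maximum M of |u| / (phi U) over [0, T] x [0, 1] cannot exceed 1: it would
   be attained at an interior point (t0, x0), where the ordinary differential
   equation of w at the fixed abscissa x0 gives |w t0 x0| <= M k phi U, so that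
   u would touch M phi U from below there. *)
Lemma comparison (u ut ux uxx w : R -> R -> R) :
  {within halfline R `*` unitI R, continuous (fun z : R * R => u z.1 z.2)} ->
  (forall T x, 0 < x < 1 -> {within `[0, T], continuous (w ^~ x)}) ->
  (forall t x : R, 0 < t -> 0 < x < 1 ->
    [/\ is_derive t 1 (u ^~ x) (ut t x), is_derive x 1 (u t) (ux t x),
        is_derive x 1 (ux t) (uxx t x) & {for x, continuous (uxx t)}]) ->
  (forall t x : R, 0 < t -> 0 < x < 1 ->
    ut t x = sigma * (uxx t x - s * u t x) + w t x) ->
  (forall t x : R, 0 < t -> 0 < x < 1 ->
    is_derive t 1 (w ^~ x) (s * u t x - w t x / sigma)) ->
  (forall t, 0 <= t -> `|u t 0| <= A * phi 0 /\ u t 1 = 0) ->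
  (forall x, 0 <= x <= 1 -> `|u 0 x| <= B * phi x) ->
  (forall x, 0 < x < 1 -> `|w 0 x| <= k * B * phi x) ->
  forall t x, 0 <= t -> 0 <= x <= 1 -> `|u t x| <= phi x * U t.
Proof.
move=> cu cw d pde dw bu u0 w0 T x T0 x01.
have U0 t : 0 < U t by apply: le_lt_trans (envelope_gtl _ _ _ _ B_gt0).
have phi0 y : 0 <= y <= 1 -> 0 < phi y by exact: weight_gt0.
pose q (z : R * R) := (phi z.2 * U z.1)^-1.
pose r (z : R * R) := `|u z.1 z.2| * q z.
pose K : set (R * R) := `[0, T] `*` `[0, 1].
have KP z : K z -> [/\ 0 <= z.1 <= T, 0 <= z.2 <= 1 & 0 < phi z.2 * U z.1].
  by case; rewrite /= !in_itv /= => ? z2; split => //; rewrite mulr_gt0 ?phi0.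
have KTx : K (T, x) by split; rewrite /= in_itv /= ?T0 ?lexx.
have cK : compact K by apply: compact_setX; exact: segment_compact.
have cr : {within K, continuous r}.
  have cuK : {within K, continuous (fun z : R * R => u z.1 z.2)}.
    apply: continuous_subspaceW cu => z /KP[/andP[? _] ? _]; split => //.
  apply/subspace_continuousP => z Kz.
  apply: cvgM.
    by apply: cvg_norm; exact: (subspace_continuousP K _).1 cuK z Kz.
  apply: cvgV; first by have [_ _ /lt0r_neq0] := KP _ Kz.
  apply: cvg_within_filter; apply: cvgM.
    apply: (@cvg_comp _ _ _ snd phi); first exact: cvg_snd.
    exact: continuous_weight.
  apply: (@cvg_comp _ _ _ fst U); first exact: cvg_fst.
  exact: continuous_envelope.
have [[t0 x0] /set_mem Kc rmax] := compact_EVT_max (ex_intro _ _ KTx) cK cr.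
set M := r (t0, x0) in rmax.
have uM z : K z -> `|u z.1 z.2| <= M * (phi z.2 * U z.1).
  move=> Kz; have [_ _ P0] := KP _ Kz.
  by rewrite -ler_pdivrMr //; apply/rmax/mem_set.
have [M1|M1] := leP M 1.
  apply: le_trans (uM _ KTx) _ => /=.
  by rewrite ler_piMl // mulr_ge0 // ltW // phi0.
have [/= /andP[t0ge t0T] x0b P0] := KP _ Kc.
have M0 : 0 < M by lra.
have uc : `|u t0 x0| = M * phi x0 * U t0.
  by rewrite -mulrA /M /r /q /= divfK // gt_eqF.
have PM : phi x0 * U t0 < M * phi x0 * U t0 by rewrite -mulrA ltr_pMl.
have AU : A < U t0 by exact: envelope_gtl.
(* At time zero [|u| <= B * phi <= phi * U 0], strictly below [M * phi * U 0] because [M > 1]. *)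
have t0_gt0 : 0 < t0.
  rewrite lt_neqAle t0ge andbT; apply/negP => /eqP t00.
  have := u0 _ x0b; rewrite [in X in `|X|]t00 uc; apply/negP; rewrite -ltNge.
  apply: le_lt_trans PM; rewrite -t00 envelope0 mulrC ler_wpM2l ?(ltW (phi0 _ x0b)) //.
  by rewrite lerDr.
(* At [x = 0] the boundary bound [A * phi 0] is below [phi 0 * U]; at [x = 1] the function [u]
   vanishes while [M * phi * U] is positive. *)
have [x0_gt0 x0_lt1] : 0 < x0 /\ x0 < 1.
  have [b0 b1] := bu _ t0ge; have [x0ge x0le] := andP x0b.
  rewrite !lt_neqAle x0ge x0le !andbT; split; apply/negP => /eqP x0E.
    move: b0; rewrite [in X in `|X|]x0E uc; apply/negP; rewrite -ltNge.
    apply: lt_trans PM; rewrite -x0E mulrC ltr_pM2l ?phi0 //.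
    by rewrite lexx ler01.
  move: b1; rewrite -x0E => ux0.
  by move: uc PM; rewrite ux0 normr0 => <-; apply/negP; rewrite -leNgt ltW.
have x0i : 0 < x0 < 1 by rewrite x0_gt0.
have phx0 := phi0 _ x0b.
have wle : `|w t0 x0| <= M * phi x0 * k * U t0.
  apply: (ode_bound (u ^~ x0) (w ^~ x0)) => //.
  - by rewrite mulr_ge0 // ltW.
  - exact: cw.
  - by move=> t /andP[t_gt0 _]; exact: dw.
  - move=> t /andP[t_gt0 tt0].
    rewrite -mulrA; apply: (uM (t, x0)); split; rewrite /= in_itv /= ?x0b //.
    by rewrite ltW //= (le_trans (ltW tt0)).
  - apply: le_trans (w0 _ x0i) _; rewrite envelope0.
    (* The factors [M] and [(A + B) / B] are both at least one, so the initial bound on [w]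
       suffices. *)
    rewrite (_ : M * phi x0 * k * (A + B) = (k * B * phi x0) * (M * ((A + B) / B))); last by field; rewrite gt_eqF.
    rewrite ler_peMr //; first by rewrite !mulr_ge0 // ltW.
    by rewrite mulr_ege1 ?(ltW M1) // ler_pdivlMr // mul1r lerDr.
exfalso; have Kx0 t : 0 < t < t0 -> K (t, x0).
  move=> /andP[t_gt0 tt0]; split; rewrite /= in_itv /= ?x0b //.
  by rewrite ltW //= (le_trans (ltW tt0)).
have Kt0 y : 0 < y < 1 -> K (t0, y).
  by move=> /andP[y0 y1]; split; rewrite /= in_itv /= ?t0ge ?t0T // !ltW.
have [dt0 _ _ cuxx] := d t0 x0 t0_gt0 x0i.
have wle' : M * phi x0 * k * U t0 = M * k * phi x0 * U t0 by ring.
(* The system is linear and odd: if [u] is negative at the maximum point, the pair [(- u, - w)]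
   touches instead. *)
have [up|un] := leP 0 (u t0 x0).
- apply: (@no_interior_touching u ux uxx (ut t0 x0) (w t0 x0) M t0 x0) => //.
  + by move=> y y01; have [] := d t0 y t0_gt0 y01.
  + by move=> y y01; have [] := d t0 y t0_gt0 y01.
  + exact: pde.
  + by move=> t /Kx0/uM/= uu; apply: le_trans (ler_norm _) _; rewrite -mulrA.
  + by move=> t /Kt0/uM/= uu; apply: le_trans (ler_norm _) _; rewrite -mulrA.
  + by rewrite -uc ger0_norm.
  + by rewrite -wle'; exact: le_trans (ler_norm _) wle.
- apply: (@no_interior_touching (fun t x => - u t x) (fun t x => - ux t x)
   (fun t x => - uxx t x) (- ut t0 x0) (- w t0 x0) M t0 x0) => //.
  + by move=> y y01; have [_ d' _ _] := d t0 y t0_gt0 y01; exact: (is_deriveN d').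
  + by move=> y y01; have [_ _ d' _] := d t0 y t0_gt0 y01; exact: (is_deriveN d').
  + by apply: continuousN.
  + by rewrite pde //; ring.
  + by move=> t /Kx0/uM/= uu; rewrite -mulrA; apply: le_trans uu; rewrite -normrN ler_norm.
  + by move=> t /Kt0/uM/= uu; rewrite -mulrA; apply: le_trans uu; rewrite -normrN ler_norm.
  + by rewrite -uc ltr0_norm.
  + by rewrite -wle'; apply: le_trans wle; rewrite -normrN ler_norm.
Qed.

End Comparison.

(** For [e = 0] the two conditions read [sigma * |s| <= k < sigma * a]; the midpoint [k] leaves room
    on both sides for a small positive [e]. *)
Lemma rate_constants {R : realType} (sigma s omega : R) :
  0 < sigma -> `|s| < s + omega ^+ 2 ->
  exists k e, [/\ 0 < k, 0 < e, `|s| <= k * (sigma^-1 - e)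
                & k + e < sigma * (s + omega ^+ 2)].
Proof.
move=> sg0 gap; set a := s + omega ^+ 2 in gap *.
have s0 : 0 <= `|s| by [].
pose k := sigma * (`|s| + a) / 2.
have k0 : 0 < k by rewrite divr_gt0 // mulr_gt0 //; lra.
pose g := a - `|s|; have g0 : 0 < g by rewrite subr_gt0.
(* The first bound keeps [k * e] within half the gap [g]; the second gives [k + e <= sigma * (3 * a
   + |s|) / 4 < sigma * a]. *)
pose e := Num.min (g / (2 * k)) (sigma * g / 4).
have e0 : 0 < e by rewrite lt_min !divr_gt0 // mulr_gt0.
have ek : e <= g / (2 * k) by rewrite ge_min lexx.
have es : e <= sigma * g / 4 by rewrite ge_min lexx orbT.
exists k, e; split => //.
- have ke : k * e <= g / 2.
    rewrite (_ : g / 2 = k * (g / (2 * k))) ?ler_pM2l //.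
    by field; rewrite gt_eqF.
  have kE : k * sigma^-1 = (`|s| + a) / 2 by rewrite /k; field; rewrite gt_eqF.
  by rewrite mulrBr kE; move: ke; rewrite /g; lra.
- have sg : 0 < sigma * g by rewrite mulr_gt0.
  by move: es sg; rewrite /k /g; lra.
Qed.

(** * Continuity on the closed strip and its restriction to lines *)

Lemma nbhs_halfline {R : realType} (t : R) : 0 < t -> nbhs t (halfline R).
Proof.
by move=> t0; near=> r; apply: ltW; near: r; exact: lt_nbhsr.
Unshelve. all: by end_near. Qed.

Lemma nbhs_unitI {R : realType} (x : R) : 0 < x < 1 -> nbhs x (unitI R).
Proof.
move=> /andP[x0 x1]; near=> r; apply/andP; split; apply: ltW; near: r.
  exact: lt_nbhsr.
exact: lt_nbhsl.
Unshelve. all: by end_near. Qed.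

Section Strip.
Context {R : realType} (F : R -> R -> R).
Hypothesis cF : {within halfline R `*` unitI R, continuous (fun z : R * R => F z.1 z.2)}.

Lemma strip_continuous_interior (t x : R) : 0 < t -> 0 < x < 1 ->
  {for (t, x), continuous (fun z : R * R => F z.1 z.2)}.
Proof.
move=> t0 x01; have [x0 x1] := andP x01.
have S : (halfline R `*` unitI R) (t, x).
  by split; rewrite /= /halfline /unitI /= ltW // ltW.
have := (subspace_continuousP _ _).1 cF _ S.
rewrite within_interior //.
by exists (halfline R, unitI R) => //; split; [exact: nbhs_halfline|exact: nbhs_unitI].
Qed.

Lemma strip_continuous_x (t x : R) : 0 < t -> 0 < x < 1 ->
  {for x, continuous (F t)}.
Proof.
move=> t0 x01; have := strip_continuous_interior _ _ t0 x01.
move=> c; apply: (@cvg_comp _ _ _ (fun y => (t, y)) (fun z : R * R => F z.1 z.2) _ _ _ _ c).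
by apply: (@cvg_pair _ _ _ _ (nbhs t) (nbhs x)); [exact: cvg_cst|exact: cvg_id].
Qed.

Lemma strip_continuous_t (T x : R) : 0 <= x <= 1 ->
  {within `[0, T], continuous (F ^~ x)}.
Proof.
move=> x01; apply/subspace_continuousP => t; rewrite /= in_itv /= => /andP[t0 _].
have := (subspace_continuousP _ _).1 cF (t, x) (conj t0 x01).
move=> c; apply: (@cvg_comp _ _ _ (fun s => (s, x)) (fun z : R * R => F z.1 z.2) _ _ _ _ c).
move=> P PS.
have {}PS : \forall z \near (t, x), (halfline R `*` unitI R) z -> P z by [].
have ct : (fun s : R => (s, x)) @ t --> (t, x).
  by apply: (@cvg_pair _ _ _ _ (nbhs t) (nbhs x)); [exact: cvg_id|exact: cvg_cst].
have H : \forall s \near t, (halfline R `*` unitI R) (s, x) -> P (s, x) := ct _ PS.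
suff : \forall s \near t, (`[0, T]%classic s : Prop) -> P (s, x) by [].
apply: filterS H => s Hs; rewrite /= in_itv /= => /andP[s0 _].
by apply: Hs; split.
Qed.

(** Compactness of the initial segment; the bounds on [u] and [w] at time zero fix the size of the
    envelope. *)
Lemma strip_bounded0 : exists2 C, 0 <= C & forall x, 0 <= x <= 1 -> `|F 0 x| <= C.
Proof.
pose K : set (R * R) := `[0, 0] `*` `[0, 1].
have KP x : 0 <= x <= 1 -> K (0, x).
  by move=> x01; split; rewrite /= in_itv /= ?lexx.
have cK : compact K by apply: compact_setX; exact: segment_compact.
have K0 : K !=set0 by exists (0, 0); apply: KP; rewrite lexx ler01.
have cN : {within K, continuous (fun z : R * R => `|F z.1 z.2|)}.
  apply/subspace_continuousP => z Kz; apply: cvg_norm.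
  apply: ((subspace_continuousP K (fun z : R * R => F z.1 z.2)).1 _ z Kz).
  apply: continuous_subspaceW cF => -[a b] [] /=; rewrite !in_itv /=.
  by move=> /andP[a0 _] b01; split.
have [c _ cmax] := compact_EVT_max K0 cK cN.
exists `|F c.1 c.2| => // x x01; apply: (cmax (0, x)).
exact/mem_set/KP.
Qed.

End Strip.

(** Both [w] and [sigma * utxx], rewritten through the equation, have this three-term form. *)
Lemma strip_continuous_comb {R : realType} (F G H : R -> R -> R) (a b : R) :
  let S := halfline R `*` unitI R in
  {within S, continuous (fun z : R * R => F z.1 z.2)} ->
  {within S, continuous (fun z : R * R => G z.1 z.2)} ->
  {within S, continuous (fun z : R * R => H z.1 z.2)} ->
  {within S, continuous (fun z : R * R => F z.1 z.2 + a * G z.1 z.2 + b * H z.1 z.2)}.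
Proof.
move=> S cF cG cH; apply/subspace_continuousP => z Sz.
apply: cvgD; last by apply: cvgMr; exact: (subspace_continuousP S _).1 cH z Sz.
apply: cvgD; first exact: (subspace_continuousP S _).1 cF z Sz.
by apply: cvgMr; exact: (subspace_continuousP S _).1 cG z Sz.
Qed.

(** * Regularity and exponential estimate for solutions of the wave equation *)

Section Solution.
Context {R : realType} (sigma mu : R) (f g d : R -> R) (u : R -> R -> R).
Hypotheses (sigma_gt0 : 0 < sigma) (solu : is_solution sigma mu f g d u).
Local Notation uxx := (dx (dx u)).
Local Notation utxx := (dx (dx (dt u))).

Lemma solution_derivatives (t x : R) : 0 < t -> 0 < x < 1 ->
  [/\ is_derive t 1 (u ^~ x) (dt u t x), is_derive x 1 (u t) (dx u t x),
      is_derive x 1 (dx u t) (uxx t x), is_derive x 1 (dt u t) (dx (dt u) t x)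
    & is_derive x 1 (dx (dt u) t) (utxx t x)].
Proof.
move=> t0 x01; have [[[_ [hu [_ [ht _ _]] [_ [hx _ _]]]] hC2] _ _ _] := solu.
have nt := nbhs_halfline _ t0; have nx := nbhs_unitI _ x01.
have ht0 : halfline R t := ltW t0.
have hx0 : unitI R x by have /andP[? ?] := x01; apply/andP; rewrite !ltW.
have [_ [hd1 [_ [hd2 _]]]] := hC2 _ (ltW t0).
split.
- by apply: is_derive_in nt _; have [] := hu t x ht0 hx0.
- by apply: is_derive_in nx _; have [] := hu t x ht0 hx0.
- by apply: is_derive_in nx _; have [] := hx t x ht0 hx0.
- exact: is_derive_in nx (hd1 _ hx0).
- exact: is_derive_in nx (hd2 _ hx0).
Qed.

Lemma solution_derivative_tt (t x : R) : 0 < t -> 0 < x < 1 ->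
  is_derive t 1 (dt u ^~ x) (dt (dt u) t x).
Proof.
move=> t0 x01; have [[[_ [_ [_ [ht _ _]] _]] _] _ _ _] := solu.
have hx0 : unitI R x by have /andP[? ?] := x01; apply/andP; rewrite !ltW.
apply: (is_derive_in _ _ _ (nbhs_halfline _ t0)).
by have [] := ht t x (ltW t0) hx0.
Qed.

(** The regularity class gives continuity of [utxx] in [x] only; solving the equation for it yields
    joint continuity at interior points. *)
Lemma solution_utxx (t x : R) : 0 < t -> 0 < x < 1 ->
  utxx t x = (dt (dt u) t x + - 1 * uxx t x + mu * dt u t x) / sigma.
Proof.
move=> t0 x01; have [_ pde _ _] := solu; rewrite pde //.
by field; rewrite gt_eqF.
Qed.

Lemma solution_continuous :
  let S := halfline R `*` unitI R in
  [/\ {within S, continuous (fun z : R * R => u z.1 z.2)},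
      {within S, continuous (fun z : R * R => dt u z.1 z.2)},
      {within S, continuous (fun z : R * R => dt (dt u) z.1 z.2)}
    & {within S, continuous (fun z : R * R => uxx z.1 z.2)}].
Proof.
by move=> S; have [[[cu [_ [ct [_ [ctt _] _]] [_ [_ _ [cxx _]]]]] _] _ _ _] := solu.
Qed.

Lemma solution_dxx_derive_t (t x : R) : 0 < t -> 0 < x < 1 ->
  is_derive t 1 (uxx ^~ x) (utxx t x).
Proof.
move=> t0 x01; have [cu ct ctt cxx] := solution_continuous.
have [x0 x1] := andP x01.
pose m := Num.min t (Num.min x (1 - x)).
have m0 : 0 < m by rewrite !lt_min t0 x0 subr_gt0.
have [mt mx mx1] : [/\ m <= t, m <= x & m <= 1 - x].
  by rewrite /m !ge_min !lexx !orbT.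
pose r := m / 2.
have [r0 rt rx rx1] : [/\ 0 < r, r < t, r < x & r < 1 - x] by rewrite /r; split; lra.
apply: (@is_derive_dxx _ u (dt u) (dx u) uxx (dx (dt u)) utxx t x r r0).
- by move=> s y st yx; apply: solution_derivatives; move: st yx; rewrite !ler_norml; lra.
- move=> s st; apply: strip_continuous_x => //.
  move: st; rewrite ler_norml; lra.
- have : {for (t, x), continuous (fun z : R * R =>
      (dt (dt u) z.1 z.2 + - 1 * uxx z.1 z.2 + mu * dt u z.1 z.2) / sigma)}.
    apply: continuousM; last exact: cst_continuous.
    apply: (strip_continuous_interior (fun t x => dt (dt u) t x + - 1 * uxx t x + mu * dt u t x)) => //.
    exact: strip_continuous_comb.
  move=> c.
  suff : (fun z : R * R => utxx z.1 z.2) @ (t, x) --> utxx t x by [].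
  rewrite (solution_utxx _ _ t0 x01).
  (* The equation holds on a whole neighbourhood of [(t, x)], so the limit of its right-hand side
     transfers to [utxx]. *)
  apply: cvg_trans c; apply: near_eq_cvg.
  have : nbhs (t, x) ([set s : R | 0 < s] `*` [set y : R | 0 < y < 1]).
    exists ([set s : R | 0 < s], [set y : R | 0 < y < 1]) => //; split => /=.
      exact: lt_nbhsr.
    by near=> y; apply/andP; split; near: y; [exact: lt_nbhsr|exact: lt_nbhsl].
  by apply: filterS => -[s y] /= [s0 y01]; rewrite solution_utxx.
Unshelve. all: by end_near. Qed.

Lemma solution_decay (theta omega A : R) :
  let s := (mu * sigma - 1) / sigma ^+ 2 in
  0 < theta -> 0 < omega -> theta + omega < pi -> `|s| < s + omega ^+ 2 ->
  0 <= A -> (forall t, 0 <= t -> `|d t| <= A * sin theta) ->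
  exists B e, [/\ 0 < B, 0 < e &
    forall t x, 0 <= t -> 0 <= x <= 1 -> `|u t x| <= A + B * expR (- e * t)].
Proof.
move=> s th0 om0 thom gap A0 dA.
have [k [e [k0 e0 ks ke]]] := rate_constants _ _ _ sigma_gt0 gap.
have [cu ct ctt cxx] := solution_continuous.
pose w t x := dt u t x + sigma * s * u t x + - sigma * uxx t x.
have cw : {within halfline R `*` unitI R, continuous (fun z : R * R => w z.1 z.2)}.
  exact: strip_continuous_comb.
pose phi := weight theta omega.
have [C1 C10 uC] := strip_bounded0 _ cu.
have [C2 C20 wC] := strip_bounded0 _ cw.
have [c /andP[c0 c1] cmin] : exists2 c, 0 <= c <= 1 & forall y, 0 <= y <= 1 -> phi c <= phi y.
  have [|c ci cmin] := @EVT_min R phi 0 1 ler01.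
    by apply: continuous_subspaceT; exact: continuous_weight.
  by exists c; [move: ci; rewrite in_itv|move=> y y01; apply: cmin; rewrite in_itv].
have m0 : 0 < phi c by apply: weight_gt0; rewrite // c0.
(* Dividing by the minimum of [phi] gives [C1 <= B * phi] and [C2 <= k * B * phi] on all of the
   interval; the added one makes [B] positive. *)
pose B := (C1 + C2 / k + 1) / phi c.
have C2k : 0 <= C2 / k by rewrite divr_ge0 // ltW.
have B0 : 0 < B by rewrite divr_gt0 //; lra.
have Bphi y : 0 <= y <= 1 -> C1 + C2 / k <= B * phi y.
  move=> y01; apply: (@le_trans _ _ (B * phi c)); last by rewrite ler_pM2l // cmin.
  by rewrite /B divfK ?gt_eqF //; lra.
exists B, e; split => // t x t0 x01.
have : `|u t x| <= phi x * envelope A B e t.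
  apply: (@comparison R theta omega sigma s k e A B _ _ _ _ _ _ _ _ _ _
      u (dt u) (dx u) uxx w) => //.
  - by move=> T y /andP[y0 y1]; apply: strip_continuous_t => //; rewrite !ltW.
  - move=> r y r0 y01; have [? ? ? _ _] := solution_derivatives _ _ r0 y01.
    by split => //; exact: strip_continuous_x.
  - by move=> r y _ _; rewrite /w; ring.
  - move=> r y r0 y01.
    have [d1 _ _ _ _] := solution_derivatives _ _ r0 y01.
    have d2 := solution_derivative_tt _ _ r0 y01.
    have d3 := solution_dxx_derive_t _ _ r0 y01.
    have := is_deriveD (is_deriveD d2 (is_deriveZ (sigma * s) d1)) (is_deriveZ (- sigma) d3).
    (* The value of [s] is the one with [sigma * s - mu = - sigma^-1]: after inserting the equation,
       [w_t] becomes [uxx - dt u / sigma], which is [s * u - w / sigma]. *)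
    rewrite (_ : _ + _ = s * u r y - w r y / sigma) //.
    rewrite solution_utxx // /w /GRing.scale /= /s.
    by field; rewrite gt_eqF.
  - have [_ _ bd _] := solu => r r0; have [-> ->] := bd r r0; split => //.
    by rewrite /weight mulr0 addr0 dA.
  - move=> y y01; apply: le_trans (uC _ y01) _; apply: le_trans _ (Bphi _ y01); lra.
  - move=> y /andP[y0 y1]; have y01 : 0 <= y <= 1 by rewrite !ltW.
    apply: le_trans (wC _ y01) _.
    have := Bphi _ y01; rewrite -(ler_pM2l k0) => H.
    rewrite -mulrA; apply: le_trans _ H.
    by rewrite mulrDr mulrCA divff ?gt_eqF // mulr1 lerDr mulr_ge0 // ltW.
move=> /le_trans; apply; rewrite ler_piMl //.
  by rewrite addr_ge0 // mulr_ge0 ?ltW // expR_gt0.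
exact: sin_le1.
Qed.

End Solution.

(** * Passage to suprema, limit superior and the gain *)

Lemma input_sup_abs {R : realType} (d : R -> R) : input d ->
  exists D, [/\ 0 <= D, sup_abs_on (halfline R) d = D%:E
               & forall t, 0 <= t -> `|d t| <= D].
Proof.
move=> [_ [M dM]].
have dsup t : 0 <= t -> (`|d t|%:E <= sup_abs_on (halfline R) d)%E.
  by move=> t0; apply: ereal_sup_ubound; exists t.
have supM : (sup_abs_on (halfline R) d <= M%:E)%E.
  by apply: ge_ereal_sup => _ [t t0 <-]; rewrite lee_fin dM.
have sup0 : (0%:E <= sup_abs_on (halfline R) d)%E.
  by apply: le_trans (dsup 0 (lexx 0)); rewrite lee_fin.
have E : sup_abs_on (halfline R) d = (fine (sup_abs_on (halfline R) d))%:E.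
  rewrite fineK // ge0_fin_numE //; apply: le_lt_trans supM _; exact: ltry.
exists (fine (sup_abs_on (halfline R) d)); split => //; first exact: fine_ge0.
by move=> t /dsup; rewrite E lee_fin.
Qed.

Lemma limsup_norm_le {R : realType} (u : R -> R -> R) (A B e : R) : 0 < B -> 0 < e ->
  (forall t x, 0 <= t -> 0 <= x <= 1 -> `|u t x| <= A + B * expR (- e * t)) ->
  (limsup_norm u <= A%:E)%E.
Proof.
move=> B0 e0 uA; apply/lee_addgt0Pr => n n0; rewrite -EFinD.
(* For [t] in [V], [expR (e * t) >= 1 + e * t > B / n], so the transient [B * expR (- e * t)] is at
   most [n]. *)
pose V := [set t : R | B / (e * n) < t].
have M0 : 0 < B / (e * n) by rewrite divr_gt0 // mulr_gt0.
apply: (@le_trans _ _ (ereal_sup [set sup_abs_on (unitI R) (u t) | t in V])).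
  apply: ereal_inf_lbound; exists V => //.
  by exists (B / (e * n)); split => //; exact: num_real.
apply: ge_ereal_sup => _ [t Vt <-]; apply: ge_ereal_sup => _ [x x01 <-].
have t0 : 0 < t by apply: lt_trans Vt.
rewrite lee_fin; apply: le_trans (uA _ _ (ltW t0) x01) _.
rewrite lerD2l mulNr expRN ler_pdivrMr ?expR_gt0 //.
move: Vt; rewrite /V /= ltr_pdivrMr ?mulr_gt0 // => Bt.
apply: le_trans (ltW Bt) _; rewrite mulrA mulrC ler_pM2l //.
by apply: le_trans (expR_ge1Dx _); rewrite mulrC lerDr.
Qed.

Lemma admissible_angle {R : realType} (s theta : R) :
  0 < theta < pi - Num.sqrt (`|s| - s) ->
  [/\ theta < pi, 0 < sin theta & `|s| < s + (pi - theta) ^+ 2].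
Proof.
move=> /andP[th0 thpi]; have sq0 : 0 <= Num.sqrt (`|s| - s) := sqrtr_ge0 _.
have thlt : theta < pi by lra.
split => //; first by rewrite sin_gt0_pi // th0.
rewrite -ltrBlDl -[ltLHS]sqr_sqrtr ?subr_ge0 ?ler_norm //.
by rewrite ltrXn2r ?nnegrE //; lra.
Qed.

Lemma solution_limsup {R : realType} (sigma mu : R) f g d u (theta D : R) :
  0 < sigma -> is_solution sigma mu f g d u ->
  let s := (mu * sigma - 1) / sigma ^+ 2 in
  0 < theta < pi - Num.sqrt (`|s| - s) ->
  0 <= D -> (forall t, 0 <= t -> `|d t| <= D) ->
  (limsup_norm u <= (D / sin theta)%:E)%E.
Proof.
move=> sg0 solu s thi D0 dD; have /andP[th0 thpi] := thi.
have [thlt sn0 _] := admissible_angle _ _ thi.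
have sq0 : 0 <= Num.sqrt (`|s| - s) := sqrtr_ge0 _.
(* The midpoint of [Num.sqrt (|s| - s)] and [pi - theta]: the strict lower bound gives the
   small-gain condition, the strict upper bound keeps [phi] positive. *)
pose omega := (Num.sqrt (`|s| - s) + (pi - theta)) / 2.
have [|||||B [e [B0 e0 uB]]] := @solution_decay _ _ _ _ _ _ _ sg0 solu theta omega (D / sin theta) th0.
- by rewrite /omega; lra.
- by rewrite /omega; lra.
(* The angle [pi - omega] is admissible too, and its gap inequality is the one wanted for
   [omega]. *)
- have thi' : 0 < pi - omega < pi - Num.sqrt (`|s| - s).
    by apply/andP; rewrite /omega; split; lra.
  by have [_ _] := admissible_angle _ _ thi'; rewrite subKr.
- by rewrite divr_ge0 // ltW.
- by move=> t /dD; rewrite divfK // gt_eqF.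
exact: limsup_norm_le B0 e0 uB.
Qed.

Theorem theorem2p3 (R : realType) (sigma mu : R)
    (sigma_gt0 : 0 < sigma) (mu_ge0 : 0 <= mu)
    (hsm : 2 < 2 * mu * sigma + sigma ^+ 2 * pi ^+ 2) :
  (exists gamma : R, 0 <= gamma /\
     forall (f g d : R -> R) (u : R -> R -> R),
       X sigma mu (f, g) -> Phi sigma mu f g d ->
       is_solution sigma mu f g d u ->
       (limsup_norm u <= gamma%:E * sup_abs_on (halfline R) d)%E) /\
  (gamma_infty sigma mu <= G0 ((mu * sigma - 1) / sigma ^+ 2))%E.
Proof.
set s := (mu * sigma - 1) / sigma ^+ 2.
split.
(* The hypothesis makes the range of angles nonempty: for [s < 0], [|s| - s = - 2 * s], and [- 2 * s
   * sigma ^+ 2 = 2 - 2 * mu * sigma < sigma ^+ 2 * pi ^+ 2]. *)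
- have sqpi : Num.sqrt (`|s| - s) < pi.
    have pi0 : 0 < pi :> R := pi_gt0 R.
    rewrite -(ltr_pXn2r (n := 2)) ?nnegrE ?sqrtr_ge0 ?(ltW pi0) //.
    rewrite sqr_sqrtr ?subr_ge0 ?ler_norm //.
    have [s0|s0] := ger0P s; first by rewrite subrr exprn_gt0.
    have sg2 : 0 < sigma ^+ 2 by rewrite exprn_gt0.
    have sE : s * sigma ^+ 2 = mu * sigma - 1 by rewrite /s divfK // gt_eqF.
    by rewrite -(ltr_pM2r sg2); lra.
  pose theta := (pi - Num.sqrt (`|s| - s)) / 2.
  have thi : 0 < theta < pi - Num.sqrt (`|s| - s).
    by apply/andP; rewrite /theta; split; lra.
  have [_ sn0 _] := admissible_angle _ _ thi.
  exists (sin theta)^-1; split; first by rewrite invr_ge0 ltW.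
  move=> f g d u _ [/input_sup_abs[D [D0 -> dD]] _] solu.
  rewrite -EFinM [_ * D]mulrC.
  exact: (solution_limsup _ _ _ _ _ _ _ _ sigma_gt0 solu thi D0 dD).
- apply: le_ereal_inf_tmp => _ [theta thi <-].
  have [_ sn0 sgap] := admissible_angle _ _ thi.
  apply: ge_ereal_sup => _ [f [g [d [u [_ [/input_sup_abs[D [D0 DE dD]] _] [t [t0 dt0]] solu ->]]]]].
  (* A nonzero value of [d] makes its supremum positive, so the quotient is an ordinary division. *)
  have Dgt0 : 0 < D by apply: lt_le_trans (dD _ t0); rewrite normr_gt0.
  rewrite DE inver gt_eqF // lee_pdivrMr //.
  apply: le_trans (solution_limsup _ _ _ _ _ _ _ _ sigma_gt0 solu thi D0 dD) _.
  have den : 0 < s + (pi - theta) ^+ 2 by exact: le_lt_trans sgap.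
  have p1 : p s theta < 1 by rewrite /p ltr_pdivrMr // mul1r.
  have p0 : 0 <= p s theta by rewrite /p divr_ge0 // ltW.
  have pn0 : 0 < sin theta * (1 - p s theta) by rewrite mulr_gt0 // subr_gt0.
  (* The gain [1 / sin theta] is enlarged by the factor [1 / (1 - p)], where [0 <= p < 1]. *)
  rewrite -EFinM lee_fin mulrC ler_pM2r // div1r lef_pV2 ?posrE //.
  by rewrite ler_piMr ?(ltW sn0) // gerBl.
Qed.
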